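(* Let $(\delta_i,Y_i)$, $i=1,\ldots,n$, be current status data with cure-rate $p$, and let $\hat F_n$ be the last component of the max-min solution $\hat F_i=\max_{h\le i}\min_{k\ge i}\frac{\sum_{j=h}^k\delta_{[j]}}{k-h+1}$, $1\le i\le n$. Then $$\hat F_n=\max_{i\le n}\frac{\sum_{j=i}^n\delta_{[j]}}{n-i+1},$$ so that $\hat F_n=1$ if and only if $\delta_{[n]}=1$. Thus for $0<p<1$ and any $0<\varepsilon<p$, $$P\{|\hat F_n-(1-p)|>\varepsilon\}\ge P\{\hat F_n=1\}=P\{\delta_{[n]}=1\}=(1-p)E\left(F(Y_{(n)})\right)\to(1-p)F(\tau_G)\quad\text{as } n\to\infty,$$ where $\tau_G=\sup\{y: G(y)<1\}$. Hence $\hat F_n$ is not a consistent estimator of $1-p$.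
   Context: Setting (Case-1 interval censoring with cure): the event times $X_1,X_2,\ldots$ are iid extended real-valued random variables with $P(X_i\le t)=(1-p)F(t)$ for real $t$ and $P(X_i=\infty)=p>0$ (the cure-rate), where $F$ is a proper distribution function. The observation times $Y_1,Y_2,\ldots$ are iid real random variables with distribution function $G$, independent of the $X_i$'s. One observes the current status data $(\delta_i,Y_i)$, $i=1,\ldots,n$, with $\delta_i=I(X_i\le Y_i)$. $Y_{(1)}\le\cdots\le Y_{(n)}$ are the order statistics of $Y_1,\ldots,Y_n$, and $\delta_{[i]}$ is the concomitant of $Y_{(i)}$ (the $\delta$ paired with $Y_{(i)}$). The vector $(\hat F_1,\ldots,\hat F_n)$ is the usual nonparametric maximum likelihood estimator (the one for no cure), i.e. the maximizer of $\sum_{i=1}^n(\delta_{[i]}\log F_i+(1-\delta_{[i]})\log(1-F_i))$ subject to $0\le F_1\le\cdots\le F_n\le1$. If $\tau_G=\infty$, $F(\tau_G)$ is read as $\lim_{x\to\infty}F(x)=1$.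
   Formalization: The limit to (1-p)F(τ_G) is claimed only if, when τ_G is finite, F is continuous at τ_G or G jumps there; otherwise it is false (F point mass at 1, Y uniform on [0,1]). Ties among the Y's are broken using the Y's alone. *)

(* Defs.v *)
From HB Require Import structures.
From mathcomp Require Import all_boot all_order all_algebra all_fingroup.
From mathcomp Require Import finmap.
From mathcomp Require Import all_classical all_reals all_analysis.
From mathcomp Require Import measurable_realfun.

Set Implicit Arguments.
Unset Strict Implicit.
Unset Printing Implicit Defensive.

Import Order.TTheory GRing.Theory Num.Theory.
Import numFieldNormedType.Exports.

Local Open Scope classical_set_scope.
Local Open Scope ring_scope.

(* Samples are indexed from 0: a sample of size n.+1 consists of the variables
   of index 0, ..., n, and ord_max : 'I_n.+1 is the index of the last order
   statistic. *)

Definition mutually_independent {d d' : measure_display}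
    {T : measurableType d} {T' : measurableType d'} {R : realType}
    (P : probability T R) (Z : nat -> T -> T') : Prop :=
  forall (J : {fset nat}) (A : nat -> set T'),
    (forall i, measurable (A i)) ->
    P (\bigcap_(i in [set` J]) (Z i @^-1` A i)) =
      (\prod_(i <- J) P (Z i @^-1` A i))%E.

Definition family_sigma {d d' : measure_display}
    {T : measurableType d} {T' : measurableType d'}
    (Z : nat -> T -> T') : set (set T) :=
  <<s \bigcup_i preimage_set_system setT (Z i) measurable >>.

Definition independent_families {d d1 d2 : measure_display}
    {T : measurableType d} {T1 : measurableType d1} {T2 : measurableType d2}
    {R : realType} (P : probability T R)
    (Z1 : nat -> T -> T1) (Z2 : nat -> T -> T2) : Prop :=
  forall A B : set T, family_sigma Z1 A -> family_sigma Z2 B ->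
    P (A `&` B) = (P A * P B)%E.

(* Case-1 interval censoring with cure-rate p.  The identical distribution
   of the X i (resp. Y i) is part of the marginal conditions. *)
Record current_status_model {d : measure_display} {T : measurableType d}
    {R : realType} (P : probability T R) (p : R)
    (F G : cumulativeBounded (0 : R) 1)
    (X : nat -> {RV P >-> \bar R}) (Y : nat -> {RV P >-> R}) : Prop := {
  cure_rate_gt0 : 0 < p ;
  event_le : forall i (t : R),
    P [set w | (X i w <= t%:E)%E] = ((1 - p) * F t)%:E ;
  event_cured : forall i, P [set w | X i w = +oo%E] = p%:E ;
  obs_cdf : forall i (t : R), P [set w | Y i w <= t] = (G t)%:E ;
  event_independent : mutually_independent P (fun i => X i : T -> \bar R) ;
  obs_independent : mutually_independent P (fun i => Y i : T -> R) ;
  event_obs_independent :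
    independent_families P (fun i => X i : T -> \bar R) (fun i => Y i : T -> R)
}.

Definition status {T : Type} {R : realType}
    (X : nat -> T -> \bar R) (Y : nat -> T -> R) (i : nat) (w : T) : bool :=
  (X i w <= (Y i w)%:E)%E.

Definition order_stat {T : Type} {R : realType} (Y : nat -> T -> R)
    (n : nat) (i : 'I_n.+1) (w : T) : R :=
  nth 0 (sort <=%R [seq Y j w | j <- iota 0 n.+1]) i.

(* s n w i is the index of the observation that is Y_(i) in the sample of size
   n.+1.  When the Y j have ties, s also breaks them; the only restriction is
   that this is done on the basis of the Y j alone, as with ties broken by
   index (a rule looking at the statuses would bias the concomitants). *)
Record sorting_rule {d : measure_display} {T : measurableType d}
    {R : realType} (Y : nat -> T -> R) (s : forall n, T -> 'S_n.+1) : Prop := {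
  sorting_ruleE : forall n (i : 'I_n.+1) w,
    Y (s n w i) w = order_stat Y i w ;
  sorting_rule_sigma : forall n (t : 'S_n.+1),
    family_sigma Y [set w | s n w = t]
}.

Definition concomitant {T : Type} {R : realType}
    (X : nat -> T -> \bar R) (Y : nat -> T -> R) (s : forall n, T -> 'S_n.+1)
    (n : nat) (w : T) (i : 'I_n.+1) : bool :=
  status X Y (s n w i) w.

Definition block_mean {R : realType} (n : nat) (b : 'I_n.+1 -> bool)
    (h k : 'I_n.+1) : R :=
  (\sum_(j < n.+1 | (h <= j <= k)%N) (b j)%:R) / (k - h + 1)%N%:R.

(* The block means lie in [0, 1] and the index ranges are nonempty, so the
   units 0 and 1 of the iterated max and min do not affect the value. *)
Definition max_min {R : realType} (n : nat) (b : 'I_n.+1 -> bool)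
    (i : 'I_n.+1) : R :=
  \big[Num.max/0]_(h < n.+1 | (h <= i)%N)
    \big[Num.min/1]_(k < n.+1 | (i <= k)%N) block_mean b h k.

Definition Fhat {T : Type} {R : realType}
    (X : nat -> T -> \bar R) (Y : nat -> T -> R) (s : forall n, T -> 'S_n.+1)
    (n : nat) (i : 'I_n.+1) (w : T) : R :=
  max_min (concomitant X Y s w) i.

Definition tau {R : realType} (G : R -> R) : \bar R :=
  ereal_sup [set y%:E | y in [set y | G y < 1]].

Definition ext_cdf {R : realType} (F : R -> R) (t : \bar R) : R :=
  match t with
  | r%:E => F r
  | +oo%E => lim (F x @[x --> +oo])
  | -oo%E => lim (F x @[x --> -oo])
  end.

Definition consistent {d : measure_display} {T : measurableType d}
    {R : realType} (P : probability T R) (est : nat -> T -> R) (theta : R) :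
    Prop :=
  forall e : R, 0 < e ->
    P [set w | e < `|est n w - theta|] @[n --> \oo] --> 0%E.

(* Main.v *)
Require Import Defs.
From HB Require Import structures.
From mathcomp Require Import all_boot all_order all_algebra all_fingroup.
From mathcomp Require Import finmap.
From mathcomp Require Import all_classical all_reals all_analysis.
From mathcomp Require Import measurable_realfun.
From mathcomp Require Import lra.

Set Implicit Arguments.
Unset Strict Implicit.
Unset Printing Implicit Defensive.

Import Order.TTheory GRing.Theory Num.Theory.
Import numFieldNormedType.Exports.

Local Open Scope classical_set_scope.
Local Open Scope ring_scope.

(** The last component of the max-min solution is the largest mean of a final
    segment of the concomitants, because the only block end available to the
    inner minimum is the last index.  All these means are at most 1; the
    segment reduced to the last concomitant has mean 1 when that concomitant
    is 1, and no segment has mean 1 otherwise.  Hence the estimator equals 1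
    exactly when the last concomitant is 1 ([max_min_last_eq1]).

    The index of the largest observation is a function of the observation
    times.  On the event that it is j, independence of the two families allows
    the observation times to be frozen ([independent_prob_section]), and the
    event time X j falls below Y j with conditional probability
    (1 - p) F(Y j) ([prob_status]).  Summing over j gives the probability of
    the last concomitant ([prob_last_concomitant]).

    For the limit, F applied to the maximum M_n of the observation times is
    almost surely at most L, the value of F at tau.  Conversely, for c < L, the
    probability q that F(Y j) < c is bounded away from 1 uniformly in j, and
    F(M_n) < c requires this of all n + 1 independent times, so that
    E F(M_n) >= c (1 - q^(n+1)) ([expectation_obs_max_ge]).  The bound on q
    comes from a point a below tau with F a >= c, or, if F jumps at a finite
    tau, from the jump of G there ([cdf_jump_tau]).

    As for inconsistency, the probability that the estimator equals 1 is at
    least the probability that X j <= Y j, for every j up to n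
    ([prob_status_le]).  Consistency would force all the latter to vanish; then
    almost surely no status is 1, the estimator is almost surely 0, and it
    stays at distance 1 - p from the parameter. *)

(** * The last component of the max-min solution *)

Section last_component.
Context {R : realType} {n : nat}.
Implicit Types (b : 'I_n.+1 -> bool) (i : 'I_n.+1).

Definition tail_mean b i : R :=
  (\sum_(j < n.+1 | (i <= j)%N) (b j)%:R) / (n - i + 1)%N%:R.

(** The second sum is nonnegative, and measures how far the mean of [b] on the
    segment is from 1. *)
Lemma tail_count b i :
  \sum_(j < n.+1 | (i <= j)%N) (b j)%:R +
  \sum_(j < n.+1 | (i <= j)%N) (~~ b j)%:R = (n - i + 1)%N%:R :> R.
Proof.
rewrite -big_split/= (eq_bigr (fun=> 1)); last first.
  by move=> j _; case: (b j); rewrite ?addr0 ?add0r.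
rewrite -(big_geq_mkord i n.+1 xpredT (fun=> 1 : R)) sumr_const_nat.
by rewrite addn1 subSn// -ltnS.
Qed.

Lemma tail_size_gt0 i : 0 < (n - i + 1)%N%:R :> R.
Proof. by rewrite addn1 ltr0Sn. Qed.

Lemma tail_mean_ge0 b i : 0 <= tail_mean b i.
Proof.
by rewrite divr_ge0 ?ler0n// sumr_ge0// => j _; rewrite ler0n.
Qed.

Lemma tail_mean_le1 b i : tail_mean b i <= 1.
Proof.
rewrite ler_pdivrMr ?tail_size_gt0// mul1r -(tail_count b) lerDl.
by apply: sumr_ge0 => j _; rewrite ler0n.
Qed.

(** A mean equal to 1 leaves no room for a false entry, and every final
    segment contains the last index. *)
Lemma tail_mean_eq1 b i : tail_mean b i = 1 -> b ord_max.
Proof.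
move/divr1_eq; rewrite -(tail_count b) => /eqP.
rewrite addrC -[X in X == _]add0r (inj_eq (addIr _)) eq_sym => /eqP.
move/psumr_eq0P => /(_ (fun j _ => ler0n _ _)) /(_ ord_max).
rewrite leq_ord => /(_ isT); case: (b ord_max) => // /eqP.
by rewrite oner_eq0.
Qed.

Lemma tail_mean_last b : tail_mean b ord_max = (b ord_max)%:R.
Proof.
rewrite /tail_mean subnn add0n divr1 (big_pred1 ord_max)// => j /=.
by rewrite -val_eqE/= eqn_leq leq_ord.
Qed.

(** At the last index the inner minimum ranges over a single block, ending
    there, and its unit 1 is harmless because means are at most 1. *)
Lemma max_min_last b :
  max_min b ord_max = \big[Num.max/0]_(i < n.+1) tail_mean b i.
Proof.
rewrite /max_min; apply: eq_big => [h|h _]; first exact: leq_ord.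
rewrite (bigminD1 ord_max)//= big_pred0; last first.
  by move=> k; rewrite -val_eqE/= eqn_leq leq_ord/= andbN.
have -> : block_mean b h ord_max = tail_mean b h.
  rewrite /block_mean /tail_mean; congr (_ / _).
  by apply: eq_bigl => j; rewrite leq_ord andbT.
exact/min_idPl/tail_mean_le1.
Qed.

Lemma max_min_last_eq1 b : max_min b ord_max = 1 :> R <-> b ord_max.
Proof.
rewrite max_min_last; split=> [|bn].
  rewrite (bigmax_eq_arg _ ord_max)// => [|i _]; last exact: tail_mean_ge0.
  exact: tail_mean_eq1.
apply/le_anti/andP; split.
  by apply/bigmax_leP; split=> // i _; exact: tail_mean_le1.
by apply/bigmax_geP; right; exists ord_max => //; rewrite tail_mean_last bn.
Qed.

Lemma max_min_last_eq0 b : (forall i, ~~ b i) -> max_min b ord_max = 0 :> R.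
Proof.
move=> b0; rewrite max_min_last big1_idem ?[LHS]maxxx// => i _.
by rewrite /tail_mean big1 ?mul0r// => j _; rewrite (negbTE (b0 j)).
Qed.

End last_component.

(** * Distribution functions and their upper end point *)

Section cdf.
Context {R : realType} (H : cumulativeBounded (0 : R) 1).

Lemma cdf_le1 x : H x <= 1.
Proof.
apply: (cvgr_to_ge (cumulativey H)); near=> y.
apply: (cumulative_is_nondecreasing H).
by near: y; exact: nbhs_pinfty_ge.
Unshelve. all: by end_near. Qed.

Lemma cdf_ge0 x : 0 <= H x.
Proof.
apply: (cvgr_to_le (cumulativeNy H)); near=> y.
apply: (cumulative_is_nondecreasing H).
by near: y; exact: nbhs_ninfty_le.
Unshelve. all: by end_near. Qed.

Lemma measurable_cdf : measurable_fun setT H.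
Proof.
apply: nondecreasing_measurable => //.
exact: (cumulative_is_nondecreasing H).
Qed.

Lemma measurable_cdf_lt c : measurable [set y : R | H y < c].
Proof.
rewrite -[X in measurable X]setTI.
by apply: measurable_fun_ltr => //; exact: measurable_cdf.
Qed.

End cdf.

Section cdf_upper_end.
Context {R : realType} (G : cumulativeBounded (0 : R) 1).

Lemma cdf_lt1 a : (a%:E < tau G)%E -> G a < 1.
Proof.
move=> /ereal_sup_gt[_ [y Gy <-]]; rewrite lte_fin => ay.
exact: le_lt_trans (cumulative_is_nondecreasing G _ _ (ltW ay)) Gy.
Qed.

Lemma tau_neq_ninfty : tau G != -oo%E.
Proof.
have [y Gy] : exists y, G y < 1.
  apply: (@filter_ex _ -oo%R).
  by apply: (cvgr_lt _ (cumulativeNy G)); exact: ltr01.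
rewrite -ltNye; apply: (@lt_le_trans _ _ y%:E); first exact: ltNyr.
by apply: ereal_sup_ubound; exists y.
Qed.

(** The value 1, taken everywhere to the right of tau, is also taken at tau by
    right continuity. *)
Lemma cdf_tau t : tau G = t%:E -> G t = 1.
Proof.
move=> tauG; apply/le_anti/andP; split; first exact: cdf_le1.
apply: (cvgr_to_ge (cumulative_is_right_continuous G t)); near=> y.
rewrite leNgt; apply/negP => Gy.
have : (y%:E <= t%:E)%E by rewrite -tauG; apply: ereal_sup_ubound; exists y.
rewrite lee_fin leNgt => /negP; apply; near: y; exact: nbhs_right_gt.
Unshelve. all: by end_near. Qed.

(** Without such a [q], the values of [G] to the left of tau would come
    arbitrarily close to 1, its value from tau on, and [G] would be continuous
    there. *)
Lemma cdf_jump_tau t : tau G = t%:E -> ~ {for t, continuous G} ->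
  exists2 q, 0 <= q < 1 & forall x, x < t -> G x <= q.
Proof.
move=> tauG; apply: contra_notP => noq.
apply/cvgrPdist_le => e e0 /=.
have [x xt Gx] : exists2 x, x < t & 1 - e < G x.
  apply: contrapT => nox; apply: noq.
  (* The bound must be nonnegative, even when 1 < e. *)
  exists (Num.max 0 (1 - e)).
    by rewrite le_max lexx/= gt_max ltr01/= ltrBlDr ltrDl.
  move=> x xt; rewrite le_max leNgt; apply/orP; right.
  by rewrite leNgt; apply/negP => Gx; apply: nox; exists x.
near=> y; rewrite (cdf_tau tauG) ger0_norm ?subr_ge0 ?cdf_le1//.
rewrite lerBlDr -lerBlDl (le_trans (ltW Gx))//.
apply: (cumulative_is_nondecreasing G); apply: ltW.
by near: y; exact: lt_nbhsr.
Unshelve. all: by end_near. Qed.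

End cdf_upper_end.

(** * A convergence criterion *)

(** The shape of the bounds obtained for the maximum of n + 1 independent
    variables: a level c below the limit is missed with probability at most
    q^(n+1). *)
Lemma cvg_geometric_lower_bound {R : realType} (u : nat -> \bar R) (L : R) :
  (forall n, 0 <= u n <= L%:E)%E ->
  (forall c, 0 <= c < L -> exists2 q, 0 <= q < 1 &
     forall n, ((c * (1 - q ^+ n.+1))%:E <= u n)%E) ->
  u n @[n --> \oo] --> L%:E.
Proof.
move=> uL low.
have ufin n : u n \is a fin_num.
  have /andP[u0 un] := uL n; rewrite ge0_fin_numE//.
  by apply: le_lt_trans un _; rewrite ltry.
have u_ge0 n : 0 <= fine (u n) by apply: fine_ge0; have /andP[] := uL n.
have u_leL n : fine (u n) <= L.
  by rewrite -lee_fin fineK//; have /andP[] := uL n.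
apply/fine_cvgP; split; first exact: nearW.
apply/cvgrPdist_le => e e0 /=.
(* The level L - e / 2 must be nonnegative to be used in the hypothesis. *)
have [Le|eL] := leP L (e / 2).
  apply: nearW => n; rewrite ger0_norm ?subr_ge0//.
  by have := u_ge0 n; lra.
have [|q /andP[q0 q1] qlow] := low (L - e / 2).
  by apply/andP; split; lra.
have qlt1 : `|q| < 1 by rewrite ger0_norm.
have /cvgrPdist_le/(_ (e / 2)) := cvg_geometric ((L - e / 2) * q) qlt1.
rewrite divr_gt0// => /(_ isT) qn.
near=> n; rewrite ger0_norm ?subr_ge0//.
have : (L - e / 2) * (1 - q ^+ n.+1) <= fine (u n) by rewrite -lee_fin fineK.
have : `|0 - (L - e / 2) * q * q ^+ n| <= e / 2 by near: n; exact: qn.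
rewrite sub0r normrN -mulrA -exprS ler_norml => /andP[_].
by lra.
Unshelve. all: by end_near. Qed.

(** * Independence *)

Section independence.
Context {d d1 d2 : measure_display} {T : measurableType d}
  {T1 : measurableType d1} {T2 : measurableType d2} {R : realType}.
Context (P : probability T R).

(** Freezing of an independent variable: the joint law is the product of the
    marginal laws, since both agree on rectangles, and the measure of [D] for
    the product is the integral of the measures of its sections. *)
Lemma independent_prob_section (Z : {RV P >-> T1}) (X : {RV P >-> T2}) :
  (forall B C, measurable B -> measurable C ->
    P (Z @^-1` B `&` X @^-1` C) = (P (Z @^-1` B) * P (X @^-1` C))%E) ->
  forall D, measurable D ->
  P [set w | D (Z w, X w)] = (\int[P]_w P [set v | D (Z w, X v)])%E.
Proof.
move=> indep D mD.
have mZX : measurable_fun setT (fun w => (Z w, X w)).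
  by apply: measurable_fun_pair.
pose ZX : {mfun T >-> (T1 * T2)%type} :=
  HB.pack (fun w => (Z w, X w)) (isMeasurableFun.Build _ _ _ _ _ mZX).
have := @product_measure_unique _ _ _ _ _ (distribution P Z) (distribution P X)
  (distribution P ZX) indep D mD.
rewrite /product_measure1 ge0_integral_pushforward//=; last first.
  exact: measurable_fun_xsection.
rewrite preimage_setT -[P _]/(distribution P ZX D) => <-.
apply: eq_integral => w _ /=.
by rewrite /distribution /pushforward/=; congr (P _); apply/seteqP; split=> v;
  rewrite /xsection/= inE.
Qed.

End independence.

Section family_sigma.
Context {d d' : measure_display} {T : measurableType d}
  {T' : measurableType d'}.
Implicit Types Z : nat -> T -> T'.

Lemma family_sigma_preimage Z i B :
  measurable B -> family_sigma Z (Z i @^-1` B).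
Proof.
move=> mB; apply: sub_sigma_algebra; exists i => //.
by exists B => //; rewrite setTI.
Qed.

Lemma family_sigma_setI Z A B :
  family_sigma Z A -> family_sigma Z B -> family_sigma Z (A `&` B).
Proof.
move=> ZA ZB.
exact: (@measurableI _ (g_sigma_algebraType
  (\bigcup_i preimage_set_system setT (Z i) measurable))).
Qed.

Lemma family_sigma_setU Z A B :
  family_sigma Z A -> family_sigma Z B -> family_sigma Z (A `|` B).
Proof.
move=> ZA ZB.
exact: (@measurableU _ (g_sigma_algebraType
  (\bigcup_i preimage_set_system setT (Z i) measurable))).
Qed.

Lemma family_sigma_setC Z A : family_sigma Z A -> family_sigma Z (~` A).
Proof.
move=> ZA.
exact: (@measurableC _ (g_sigma_algebraType
  (\bigcup_i preimage_set_system setT (Z i) measurable))).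
Qed.

Lemma family_sigma_set0 Z : family_sigma Z set0.
Proof.
exact: (@measurable0 _ (g_sigma_algebraType
  (\bigcup_i preimage_set_system setT (Z i) measurable))).
Qed.

Lemma family_sigma_fin Z (I : finType) (f : T -> I) (Q : I -> Prop) :
  (forall i, family_sigma Z [set w | f w = i]) ->
  family_sigma Z [set w | Q (f w)].
Proof.
move=> Zf.
have -> : [set w | Q (f w)] = \bigcup_(i in [set i | Q i]) [set w | f w = i].
  by apply/seteqP; split=> [w Qw|w [i Qi /= ->]//]; exists (f w).
apply: (@fin_bigcup_measurable _ (g_sigma_algebraType
  (\bigcup_i preimage_set_system setT (Z i) measurable))) => // i _.
exact: Zf.
Qed.

Lemma family_sigma_measurable Z :
  (forall i, measurable_fun setT (Z i)) -> family_sigma Z `<=` measurable.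
Proof.
move=> mZ; apply: smallest_sub; first exact: sigma_algebra_measurable.
by move=> _ [i _ [B mB <-]]; exact: mZ.
Qed.

End family_sigma.

Lemma ge0_integral_fibers {d : measure_display} {T : measurableType d}
    {R : realType} (mu : {measure set T -> \bar R}) (I : finType) (f : T -> I)
    (g : T -> \bar R) :
  (forall i, measurable [set w | f w = i]) ->
  measurable_fun setT g -> (forall w, (0 <= g w)%E) ->
  (\int[mu]_w g w = \sum_(i : I) \int[mu]_(w in [set w | f w = i]) g w)%E.
Proof.
move=> mf mg g0.
have U : \big[setU/set0]_(i <- index_enum I) [set w | f w = i] = setT.
  apply/seteqP; split=> // w _; rewrite -bigcup_seq.
  by exists (f w) => //=; rewrite mem_index_enum.
rewrite -U ge0_integral_bigsetU//=.
- exact: index_enum_uniq.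
- by move=> i k _ _ [w [/= <- <-]].
- by rewrite U.
Qed.

(** * The law of the last concomitant *)

Section model.
Context {d : measure_display} {T : measurableType d} {R : realType}
  {P : probability T R} {p : R} {F G : cumulativeBounded (0 : R) 1}
  {X : nat -> {RV P >-> \bar R}} {Y : nat -> {RV P >-> R}}
  {s : forall n, T -> 'S_n.+1}.
Context (model : current_status_model p F G X Y) (sorting : sorting_rule Y s).

Local Notation obs_max n := (order_stat Y (@ord_max n)).

Let obs_sigma := family_sigma (fun i => Y i : T -> R).

Lemma obs_sigma_measurable A : obs_sigma A -> measurable A.
Proof. by apply: family_sigma_measurable => i; exact: measurable_funPT. Qed.

(** The event [A] is absorbed into the frozen variable, by sending [Y j] to
    minus infinity off [A]: this keeps a single variable, independent of
    [X j]. *)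
Lemma prob_status A j : obs_sigma A ->
  P (A `&` [set w | status X Y j w]) =
    (\int[P]_(w in A) ((1 - p) * F (Y j w))%:E)%E.
Proof.
move=> sA.
pose Zf w : \bar R := if w \in A then (Y j w)%:E else -oo%E.
have sZ B : measurable B -> obs_sigma (Zf @^-1` B).
  move=> mB.
  have -> : Zf @^-1` B = (A `&` Y j @^-1` (EFin @^-1` B)) `|`
                         (~` A `&` [set _ | B -oo%E]).
    apply/seteqP; split=> w; rewrite /Zf/=.
      by case: ifPn => [/set_mem|/negP]; [left|rewrite inE; right].
    by case=> -[Aw Bw]; [rewrite mem_set|rewrite memNset].
  apply: family_sigma_setU; apply: family_sigma_setI => //.
  - apply: family_sigma_preimage.
    by rewrite -[X in measurable X]setTI; exact: EFin_measurable.
  - exact: family_sigma_setC.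
  - have [BNy|BNy] := pselect (B -oo%E).
      rewrite (_ : [set _ | _] = setT); last by apply/seteqP; split=> ?.
      rewrite -setC0.
      by apply: family_sigma_setC; apply: family_sigma_set0.
    rewrite (_ : [set _ | _] = set0); last by apply/seteqP; split=> ?.
    exact: family_sigma_set0.
have mZ : measurable_fun setT Zf.
  by move=> _ B mB; rewrite setTI; apply: obs_sigma_measurable; apply: sZ.
pose Z : {RV P >-> \bar R} := HB.pack Zf (isMeasurableFun.Build _ _ _ _ _ mZ).
have indep B C : measurable B -> measurable C ->
    P (Z @^-1` B `&` X j @^-1` C) = (P (Z @^-1` B) * P (X j @^-1` C))%E.
  move=> mB mC; rewrite setIC muleC.
  apply: (event_obs_independent model); last by apply: sZ.
  by apply: family_sigma_preimage.
(* The first condition excludes X j = -oo off A. *)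
pose D : set (\bar R * \bar R) :=
  [set q | (-oo < q.1)%E] `&` [set q | (q.2 <= q.1)%E].
have mD : measurable D.
  have mE : measurable [set q : \bar R * \bar R | (-oo < q.1)%E].
    by rewrite -[X in measurable X]setTI; exact: measurable_lte.
  by apply: measurable_lee => //; apply: measurable_funTS.
have := independent_prob_section indep mD.
have -> : [set w | D (Z w, X j w)] = A `&` [set w | status X Y j w].
  apply/seteqP; split=> w; rewrite /D/= /Zf /status.
    by case: ifPn => [/set_mem Aw [_ ?]//|_ []]; rewrite ltxx.
  by move=> [Aw ?]; rewrite mem_set// ltNyr.
move=> ->; rewrite [RHS]integral_mkcond; apply: eq_integral => w _.
rewrite patchE /D/= /Zf; case: ifPn => _.
  rewrite -(event_le model j); congr (P _).
  by apply/seteqP; split=> v /=; rewrite ltNyr// => -[].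
rewrite (_ : [set _ | _] = set0) ?measure0//.
by apply/seteqP; split=> v //= []; rewrite ltxx.
Qed.

Lemma obs_le_max n (j : nat) w : (j <= n)%N -> Y j w <= obs_max n w.
Proof.
move=> jn; rewrite /order_stat; set t := sort _ _.
have st : sorted <=%R t by apply: sort_sorted; exact: le_total.
have szt : size t = n.+1 by rewrite size_sort size_map size_iota.
have Yt : Y j w \in t.
  by rewrite mem_sort; apply/mapP; exists j => //; rewrite mem_iota.
rewrite -(nth_index 0 Yt); apply: (sorted_leq_nth le_trans lexx) => //.
- by rewrite inE index_mem.
- by rewrite inE szt.
- by rewrite -ltnS -szt index_mem.
Qed.

Lemma sigma_last_index n (j : 'I_n.+1) :
  obs_sigma [set w | s n w ord_max = j].
Proof.
exact: (family_sigma_fin (fun t : 'S_n.+1 => t ord_max = j)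
  (sorting_rule_sigma sorting (n := n))).
Qed.

Lemma measurable_status j : measurable [set w | status X Y j w].
Proof.
rewrite -[X in measurable X]setTI; apply: measurable_lee => //.
exact/measurable_EFinP.
Qed.

Lemma measurable_concomitant n (i : 'I_n.+1) :
  measurable [set w | concomitant X Y s w i].
Proof.
have -> : [set w | concomitant X Y s w i] = \bigcup_(j in [set: 'I_n.+1])
    ([set w | s n w i = j] `&` [set w | status X Y j w]).
  apply/seteqP; split=> [w cw|w [j _ [/= sj]]].
    by exists (s n w i).
  by rewrite /concomitant sj.
apply: fin_bigcup_measurable => // j _.
apply: measurableI; last exact: measurable_status.
apply: obs_sigma_measurable.
exact: (family_sigma_fin (fun t : 'S_n.+1 => t i = j)
  (sorting_rule_sigma sorting (n := n))).
Qed.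

Lemma measurable_obs_max n : measurable_fun setT (obs_max n).
Proof.
move=> _ B mB; rewrite setTI.
have -> : obs_max n @^-1` B = \bigcup_(j in [set: 'I_n.+1])
    ([set w | s n w ord_max = j] `&` Y j @^-1` B).
  apply/seteqP; split=> [w Bw|w [j _ [/= sj]]].
    exists (s n w ord_max) => //; split=> //=.
    by rewrite (sorting_ruleE sorting).
  by rewrite -sj (sorting_ruleE sorting).
apply: fin_bigcup_measurable => // j _.
apply: measurableI.
  by apply: obs_sigma_measurable; apply: sigma_last_index.
exact: measurable_funPTI.
Qed.

Lemma measurable_F_obs_max n : measurable_fun setT (fun w => F (obs_max n w)).
Proof.
exact: (measurableT_comp (measurable_cdf F) (measurable_obs_max n)).
Qed.

(** On the event that observation j is the largest, the last concomitant is
    the status of j and the maximum is [Y j]; this event only depends on the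
    observation times, so [prob_status] applies to it. *)
Lemma prob_last_concomitant n : p <= 1 ->
  P [set w | concomitant X Y s w (@ord_max n)] =
  ((1 - p)%:E * 'E_P[(fun w => F (obs_max n w))])%E.
Proof.
move=> p1.
have mfib j := obs_sigma_measurable (@sigma_last_index n j).
rewrite unlock -ge0_integralZl//; last 3 first.
- exact/measurable_EFinP/measurable_F_obs_max.
- by move=> w _; rewrite lee_fin cdf_ge0.
- by rewrite lee_fin subr_ge0.
transitivity
    (\int[P]_w (\1_[set v | concomitant X Y s v (@ord_max n)] w)%:E)%E.
  by rewrite integral_indic ?setIT//; exact: measurable_concomitant.
rewrite !(ge0_integral_fibers P (f := fun w => s n w ord_max))//; last 3 first.
- apply/measurable_EFinP; apply: measurable_indic.
  exact: measurable_concomitant.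
- under eq_fun do rewrite -EFinM.
  by apply/measurable_EFinP/measurable_funM => //; exact: measurable_F_obs_max.
- by move=> w; rewrite -EFinM lee_fin mulr_ge0 ?subr_ge0 ?cdf_ge0.
apply: eq_bigr => j _.
rewrite integral_indic//; last exact: measurable_concomitant.
rewrite (_ : _ `&` _ =
    [set w | s n w ord_max = j] `&` [set w | status X Y j w]); last first.
  apply/seteqP; split=> w []; rewrite /concomitant /=.
    by move=> + sj; rewrite sj.
  by move=> sj; rewrite sj.
apply: etrans (prob_status j (sigma_last_index j)) _.
apply: eq_integral => w /set_mem/= sj.
by rewrite -EFinM -(sorting_ruleE sorting) sj.
Qed.

(** * The limit of E F(Y_(n)) *)

Lemma prob_all_obs B q n : measurable B ->
  (forall j, (P (Y j @^-1` B) <= q%:E)%E) ->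
  (P (\bigcap_(j in [set k | (k <= n)%N]) (Y j @^-1` B)) <= (q ^+ n.+1)%:E)%E.
Proof.
move=> mB Bq.
have := obs_independent model (seq_fset tt (iota 0 n.+1)) (fun=> mB).
have -> : [set` seq_fset tt (iota 0 n.+1)] = [set k | (k <= n)%N].
  apply/seteqP; split=> k kJ; have := seq_fsetE tt (iota 0 n.+1) k;
    rewrite mem_iota add0n ltnS => E; first exact: (etrans (esym E) kJ).
  exact: (etrans E kJ).
move=> ->; rewrite (perm_big _ (seq_fset_perm _ _)) undup_id ?iota_uniq//.
rewrite -[in (q ^+ _)](size_iota 0 n.+1); elim: (iota 0 n.+1) => [|k ks IH].
  by rewrite big_nil expr0.
rewrite big_cons exprS EFinM lee_pmul//.
by apply: prode_ge0 => // i _; exact: measure_ge0.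
Qed.

(** By Markov's inequality, since F(Y_(n)) < c forces F(Y j) < c for every
    observation of the sample. *)
Lemma expectation_obs_max_ge c q n : 0 <= c ->
  (forall j, (P [set w | (F (Y j w) < c)%R] <= q%:E)%E) ->
  ((c * (1 - q ^+ n.+1))%:E <= 'E_P[(fun w => F (obs_max n w))])%E.
Proof.
move=> c0 cq.
pose B := [set w | c <= F (obs_max n w)].
have mB : measurable B.
  rewrite -[B]setTI.
  by apply: measurable_fun_ler => //; exact: measurable_F_obs_max.
have PB : (P (~` B) <= (q ^+ n.+1)%:E)%E.
  apply: le_trans (prob_all_obs n (measurable_cdf_lt F c) cq).
  apply: le_measure; rewrite ?inE.
  - exact: measurableC.
  - apply: bigcap_measurableType => k _.
    exact: (measurable_funPTI _ (measurable_cdf_lt F c)).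
  - move=> w /= /negP; rewrite -ltNge => FM k kn /=.
    apply: le_lt_trans FM; apply: (cumulative_is_nondecreasing F).
    exact: obs_le_max.
have mFM : measurable_fun setT (fun w => (F (obs_max n w))%:E).
  exact/measurable_EFinP/measurable_F_obs_max.
rewrite unlock; apply: (@le_trans _ _ (\int[P]_(w in B) c%:E)%E); last first.
  apply: (@le_trans _ _ (\int[P]_(w in B) (F (obs_max n w))%:E)%E).
    by apply: ge0_le_integral => //; exact: measurable_funTS.
  by apply: ge0_subset_integral => // w _; rewrite lee_fin cdf_ge0.
rewrite integral_cst// EFinM; apply: lee_wpmul2l; first by rewrite lee_fin.
have := probability_setC P (measurableC mB); rewrite setCK => PBE.
rewrite [leRHS]PBE.
by rewrite EFinB; exact: leeB.
Qed.

Lemma prob_obs_le_preimage (B : set R) j a : measurable B ->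
  (forall y, B y -> y <= a) -> (P (Y j @^-1` B) <= (G a)%:E)%E.
Proof.
move=> mB Ba; rewrite -(obs_cdf model j); apply: le_measure; rewrite ?inE.
- exact: measurable_funPTI.
- rewrite -[X in measurable X]setTI.
  by apply: measurable_fun_ler => //; exact: measurable_funPT.
- by move=> w /Ba.
Qed.

Lemma prob_cdf_lt c a j : c <= F a ->
  (P [set w | F (Y j w) < c]%R <= (G a)%:E)%E.
Proof.
move=> ca; apply: (prob_obs_le_preimage j (measurable_cdf_lt F c)) => y Fy.
rewrite leNgt; apply/negP => ay; move: Fy; apply/negP; rewrite -leNgt.
apply: le_trans ca _; apply: (cumulative_is_nondecreasing F).
exact: ltW.
Qed.

(** The event [Y j < t] is the increasing union of the events
    [Y j <= t - 1/(k+1)], whose probabilities are values of [G] to the left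
    of [t]. *)
Lemma prob_obs_lt t q j : (forall x, x < t -> G x <= q) ->
  (P [set w | Y j w < t]%R <= q%:E)%E.
Proof.
move=> Gq.
have mlt k : measurable (Y j @^-1` [set y | y <= t - k.+1%:R^-1]).
  apply: measurable_funPTI; rewrite -[X in measurable X]setTI.
  by apply: measurable_fun_ler.
have -> : [set w | Y j w < t] =
    \bigcup_k (Y j @^-1` [set y | y <= t - k.+1%:R^-1]).
  apply/seteqP; split=> [w /= wt|w [k _ /=] wt].
    have [k kt] := ltr_add_invr wt.
    by exists k => //=; rewrite lerBrDr ltW.
  by apply: le_lt_trans wt _; rewrite ltrBlDr ltrDl invr_gt0 ltr0Sn.
set A := fun k : nat => _ in mlt *.
have cvA : P (A k) @[k --> \oo] --> P (\bigcup_k A k).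
  apply: nondecreasing_cvg_mu => //; first exact: bigcupT_measurable.
  move=> m n mn; apply/subsetPset => w /= /le_trans; apply.
  by rewrite lerD2l lerN2 lef_pV2 ?posrE ?ltr0Sn// ler_nat.
apply: (cvge_to_le cvA); apply: nearW => k /=.
rewrite /A (obs_cdf model) lee_fin Gq//.
by rewrite ltrBlDr ltrDl invr_gt0 ltr0Sn.
Qed.

Lemma obs_le_tau t : tau G = t%:E -> {ae P, forall w, forall j, Y j w <= t}.
Proof.
move=> tauG; apply: ae_foralln => j.
have mY : measurable [set w | Y j w <= t].
  rewrite -[X in measurable X]setTI.
  by apply: measurable_fun_ler => //; exact: measurable_funPT.
exists (~` [set w | Y j w <= t]); split => //; first exact: measurableC.
apply: etrans (probability_setC P mY) _.
by rewrite (obs_cdf model) (cdf_tau tauG) subee.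
Qed.

Lemma expectation_obs_max_le n L : 0 <= L ->
  {ae P, forall w, forall j, F (Y j w) <= L} ->
  ('E_P[(fun w => F (obs_max n w))] <= L%:E)%E.
Proof.
move=> L0 FL; rewrite -(expectation_cst P L); apply: expectation_le => //.
- exact: measurable_F_obs_max.
- by move=> w; exact: cdf_ge0.
- by apply: filterS FL => w Lw; rewrite -(sorting_ruleE sorting).
Qed.

(** Let c be below the value of [F] at tau.  If tau is infinite or [F] is
    continuous there, c is reached at some a < tau, and [q = G a].  Otherwise
    [G] jumps at tau, and [q] bounds the probability of staying strictly below
    tau. *)
Lemma cvg_expectation_obs_max :
  (forall t : R, tau G = t%:E ->
     {for t, continuous F} \/ ~ {for t, continuous G}) ->
  'E_P[(fun w => F (obs_max n w))]%E @[n --> \oo] --> (ext_cdf F (tau G))%:E.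
Proof.
move=> FG.
have E0 n : (0 <= 'E_P[(fun w => F (obs_max n w))])%E.
  by apply: expectation_ge0 => w; exact: cdf_ge0.
case tauG : (tau G) => [t||] /=; last by have := tau_neq_ninfty G; rewrite tauG.
- apply: cvg_geometric_lower_bound => [n|c /andP[c0 cF]].
    rewrite E0/=; apply: expectation_obs_max_le; first exact: cdf_ge0.
    apply: filterS (obs_le_tau tauG) => w Yt j.
    exact: (cumulative_is_nondecreasing F).
  have [Fc|Gj] := FG t tauG.
    have [a at_ ca] : exists2 a, a < t & c < F a.
      have FN := cvg_at_left_filter Fc.
      have /filter_ex[a [? ?]] : \forall a \near t^'-, a < t /\ c < F a.
        near=> a; split; near: a; first exact: nbhs_left_lt.
        exact: (cvgr_gt _ FN).
      by exists a.
    exists (G a); first by rewrite cdf_ge0 cdf_lt1// tauG lte_fin.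
    move=> n; apply: expectation_obs_max_ge => // j.
    exact/prob_cdf_lt/ltW.
  have [q q01 Gq] := cdf_jump_tau tauG Gj.
  exists q => // n; apply: expectation_obs_max_ge => // j.
  apply: le_trans (prob_obs_lt j Gq); apply: le_measure; rewrite ?inE.
  - exact: (measurable_funPTI _ (measurable_cdf_lt F c)).
  - rewrite -[X in measurable X]setTI.
    by apply: measurable_fun_ltr => //; exact: measurable_funPT.
  - move=> w /= Fc; rewrite ltNge; apply/negP => tY.
    have := cumulative_is_nondecreasing F _ _ tY.
    by rewrite leNgt (lt_trans Fc cF).
- rewrite (cvg_lim _ (cumulativey F))//.
  apply: cvg_geometric_lower_bound => [n|c /andP[c0 c1]].
    rewrite E0/=; apply: expectation_obs_max_le => //.
    by apply: nearW => w j; exact: cdf_le1.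
  have [a ca] : exists a, c < F a.
    apply: (@filter_ex _ +oo%R).
    exact: (cvgr_gt _ (cumulativey F)).
  exists (G a); first by rewrite cdf_ge0 cdf_lt1// tauG ltry.
  move=> n; apply: expectation_obs_max_ge => // j.
  exact/prob_cdf_lt/ltW.
Unshelve. all: by end_near. Qed.

(** * Inconsistency *)

(** The estimator takes finitely many values, through the vector of
    concomitants. *)
Lemma measurable_Fhat n (Q : R -> Prop) :
  measurable [set w | Q (Fhat X Y s (@ord_max n) w)].
Proof.
pose f w : {ffun 'I_n.+1 -> bool} := [ffun i => concomitant X Y s w i].
have fE w : Fhat X Y s (@ord_max n) w = max_min (f w) ord_max.
  rewrite /Fhat; congr (max_min _ _).
  by apply/funext => i; rewrite ffunE.
have -> : [set w | Q (Fhat X Y s (@ord_max n) w)] =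
    \bigcup_(b in [set b : {ffun 'I_n.+1 -> bool} | Q (max_min b ord_max)])
      \bigcap_(i in [set: 'I_n.+1]) [set w | concomitant X Y s w i = b i].
  apply/seteqP; split=> [w /=|w [b /= Qb wb]].
    by rewrite fE => Qw; exists (f w) => // i _ /=; rewrite ffunE.
  rewrite fE (_ : f w = b)//.
  by apply/ffunP => i; rewrite ffunE; exact: wb.
apply: fin_bigcup_measurable => // b _.
apply: fin_bigcap_measurable => // i _; case: (b i).
  exact: measurable_concomitant.
rewrite (_ : [set _ | _] = ~` [set w | concomitant X Y s w i]).
  exact/measurableC/measurable_concomitant.
by apply/seteqP; split=> w /= => [->//|/negP/negbTE].
Qed.

Lemma prob_Fhat_eq1 n :
  P [set w | Fhat X Y s (@ord_max n) w = 1] =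
  P [set w | concomitant X Y s w (@ord_max n)].
Proof. by congr (P _); apply/seteqP; split=> w /=; apply max_min_last_eq1. Qed.

Lemma prob_Fhat_eq1_le e n : e < p ->
  (P [set w | Fhat X Y s (@ord_max n) w = 1%R] <=
   P [set w | (e < `|Fhat X Y s (@ord_max n) w - (1 - p)|)%R])%E.
Proof.
move=> ep; apply: le_measure; rewrite ?inE.
- exact: (measurable_Fhat n (fun x : R => x = 1)).
- exact: (measurable_Fhat n (fun x : R => e < `|x - (1 - p)|)).
- move=> w /= ->; rewrite opprB addrC subrK ger0_norm//.
  exact/ltW/(cure_rate_gt0 model).
Qed.

(** Both sides are expectations, of (1 - p) F(Y j) and (1 - p) F(Y_(n)), and
    [Y j] is at most Y_(n). *)
Lemma prob_status_le j n : p <= 1 -> (j <= n)%N ->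
  (P [set w | status X Y j w] <=
   P [set w | concomitant X Y s w (@ord_max n)])%E.
Proof.
move=> p1 jn; rewrite prob_last_concomitant// unlock.
rewrite -ge0_integralZl//; last 3 first.
- exact/measurable_EFinP/measurable_F_obs_max.
- by move=> w _; rewrite lee_fin cdf_ge0.
- by rewrite lee_fin subr_ge0.
rewrite -[X in (P X <= _)%E]setTI prob_status; last first.
  by rewrite -setC0; apply: family_sigma_setC; apply: family_sigma_set0.
have p1' : 0 <= 1 - p by rewrite subr_ge0.
apply: ge0_le_integral => //.
- by move=> w _; rewrite lee_fin mulr_ge0 ?cdf_ge0.
- apply/measurable_EFinP/measurable_funM => //.
  by apply: measurableT_comp => //; exact: measurable_cdf.
- under eq_fun do rewrite -EFinM.
  by apply/measurable_EFinP/measurable_funM => //; exact: measurable_F_obs_max.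
- move=> w _; rewrite -EFinM lee_fin ler_wpM2l//.
  by apply: (cumulative_is_nondecreasing F); exact: obs_le_max.
Qed.

(** If the probability that the estimator is 1 tended to 0, every status would
    be 0 almost surely, and the estimator would be almost surely 0. *)
Lemma Fhat_not_consistent : p < 1 ->
  ~ consistent P (fun n => Fhat X Y s (@ord_max n)) (1 - p).
Proof.
move=> p1 cons; have p0 := cure_rate_gt0 model.
(* The distances from 1 - p to 1 and to 0 are p and 1 - p, both above e. *)
pose e := Num.min p (1 - p) / 2.
have m0 : 0 < Num.min p (1 - p) by rewrite lt_min p0 subr_gt0.
have e0 : 0 < e by rewrite divr_gt0.
have em : e < Num.min p (1 - p) by rewrite /e ltr_pdivrMr// ltr_pMr// ltr1n.
have /andP[ep e1p] : (e < p) && (e < 1 - p) by rewrite -lt_min.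
have status0 j : P [set w | status X Y j w] = 0%E.
  apply/le_anti/andP; split; last exact: measure_ge0.
  apply: (cvge_to_ge (cons e e0)); near=> n.
  apply: le_trans (prob_Fhat_eq1_le n ep); rewrite prob_Fhat_eq1.
  apply: prob_status_le; first exact: ltW.
  by near: n; exact: nbhs_infty_ge.
have aeF : {ae P, forall w, forall j, ~~ status X Y j w}.
  apply: ae_foralln => j; exists [set w | status X Y j w]; split.
  - exact: measurable_status.
  - exact: status0.
  - by move=> w /= /negP; rewrite negbK.
have far n : P [set w | e < `|Fhat X Y s (@ord_max n) w - (1 - p)|] = 1%E.
  set A := [set w | _]; have mA : measurable A.
    exact: (measurable_Fhat n (fun x : R => e < `|x - (1 - p)|)).
  have PA0 : P (~` A) = 0%E.
    apply/negligibleP; first exact: measurableC.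
    apply: negligibleS aeF => w /= Aw noS; apply: Aw; rewrite /A/=.
    rewrite /Fhat max_min_last_eq0 ?sub0r ?normrN.
      by rewrite ger0_norm// subr_ge0 ltW.
    by move=> i; exact: noS.
  by have := probability_setC P (measurableC mA); rewrite setCK PA0 sube0.
have : (1 <= 0 :> \bar R)%E.
  by apply: (cvge_to_ge (cons e e0)); apply: nearW => n; rewrite far.
by rewrite lee_fin ler10.
Unshelve. all: by end_near. Qed.

End model.

(** * The theorem *)

Theorem mainTheorem3 (d : measure_display) (T : measurableType d)
    (R : realType) (P : probability T R) (p : R)
    (F G : cumulativeBounded (0 : R) 1)
    (X : nat -> {RV P >-> \bar R}) (Y : nat -> {RV P >-> R})
    (s : forall n, T -> 'S_n.+1)
    (hXY : current_status_model p F G X Y)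
    (hs : sorting_rule Y s) :
  (forall (n : nat) (w : T),
     Fhat X Y s (@ord_max n) w =
       \big[Num.max/0]_(i < n.+1)
         ((\sum_(j < n.+1 | (i <= j)%N) (concomitant X Y s w j)%:R)
            / (n - i + 1)%N%:R)
     /\ (Fhat X Y s (@ord_max n) w = 1 <-> concomitant X Y s w (@ord_max n)))
  /\
  (p < 1 ->
     (forall eps : R, 0 < eps -> eps < p -> forall n : nat,
        [/\ (P [set w | (eps < `|Fhat X Y s (@ord_max n) w - (1 - p)|)%R]
               >= P [set w | Fhat X Y s (@ord_max n) w = 1%R])%E,
            P [set w | Fhat X Y s (@ord_max n) w = 1] =
              P [set w | concomitant X Y s w (@ord_max n)] &
            P [set w | concomitant X Y s w (@ord_max n)] =
              ((1 - p)%:E *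
                 'E_P[(fun w => F (order_stat Y (@ord_max n) w))])%E])
     /\
     (* needed only for the limit, and only if tau G is finite: Y_(n) may
        stay below tau G, so a jump of F there is seen only if G has one *)
     ((forall t : R, tau G = t%:E ->
         {for t, continuous F} \/ ~ {for t, continuous G}) ->
      ((1 - p)%:E * 'E_P[(fun w => F (order_stat Y (@ord_max n) w))])%E
        @[n --> \oo] --> ((1 - p) * ext_cdf F (tau G))%:E)
     /\
     ~ consistent P (fun n => Fhat X Y s (@ord_max n)) (1 - p)).
Proof.
split=> [n w|p1].
  by split; [exact: max_min_last|exact: max_min_last_eq1].
split=> [eps eps0 epsp n|].
  split; first exact: (prob_Fhat_eq1_le hXY hs n epsp).
  - exact: prob_Fhat_eq1.
  - exact: (prob_last_concomitant hXY hs n (ltW p1)).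
split=> [FG|]; last exact: (Fhat_not_consistent hXY hs).
by rewrite EFinM; apply: cvgeZl => //; exact: (cvg_expectation_obs_max hXY hs).
Qed.
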